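(* Let $\mu,\nu$ be atomless Borel probability measures on $\mathbb{R}$. Let $l_j(x,y)=a_jx+b_jy+c_j$, $1\le j\le n$, be affine functions on $\mathbb{R}^2$ such that every two of them, $l_i,l_j$ with $i\ne j$, satisfy the non-degeneracy assumption (A). Put $c=\min\{l_1,\ldots,l_n\}$ and suppose that every set $\{(x,y)\in\mathbb{R}^2: c(x,y)=l_i(x,y)\}$, $1\le i\le n$, has non-empty interior. For every $(\mu,\nu)$-partition $\mathcal{P}=(I_1,\ldots,I_k;\,J_1,\ldots,J_k)$ define $$J(\mathcal{P})=\sum_{i}\ \min_{j}\Bigl(a_j\int_{I_i}x\,d\mu+b_j\int_{J_i}y\,d\nu+c_j\,\mu(I_i)\Bigr),$$ where $i$ runs over $1,\ldots,k$ and $j$ over $1,\ldots,n$. Then the minimal value of the functional $J$ over all $(\mu,\nu)$-partitions of order not greater than $n$ coincides with the minimum $$K(\mu,\nu)=\min_{\pi\in\Pi(\mu,\nu)}\int c\,d\pi$$ of the Kantorovich functional for the cost function $c$.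
   Context: Assumption (A): two distinct affine functions $l_1,l_2$ on $\mathbb{R}^2$ satisfy (A) if the set $\{l_1=l_2\}$ is non-empty and is not parallel to either of the coordinate axes. $\Pi(\mu,\nu)$ denotes the set of Borel probability measures on $\mathbb{R}\times\mathbb{R}$ with marginals $\mu$ (first coordinate) and $\nu$ (second coordinate). A $(\mu,\nu)$-partition of order $k$ consists of two representations of the real line (the $x$-axis and the $y$-axis) as unions of $k$ non-empty disjoint connected sets, $\mathbb{R}=I_1\cup\cdots\cup I_k$ and $\mathbb{R}=J_1\cup\cdots\cup J_k$, such that $\mu(I_i)=\nu(J_i)>0$ for all $i\in\{1,\ldots,k\}$.
   Formalization: The measures μ and ν are additionally assumed to have finite first moments, without which the integrals of x and y in J (for example for the order-one partition) need not exist. *)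

(* Defs.v *)
From HB Require Import structures.
From mathcomp Require Import all_boot all_order all_algebra.
From mathcomp Require Import all_classical all_reals all_analysis.
Import Order.TTheory GRing.Theory Num.Theory.
Import numFieldNormedType.Exports.

Set Implicit Arguments.
Unset Strict Implicit.
Unset Printing Implicit Defensive.

Local Open Scope classical_set_scope.
Local Open Scope ring_scope.

Definition atom d (T : measurableType d) (R : realType)
    (mu : {measure set T -> \bar R}) (A : set T) : Prop :=
  [/\ measurable A, (0 < mu A)%E &
      forall B, measurable B -> B `<=` A -> mu B = 0%E \/ mu B = mu A].

Definition atomless d (T : measurableType d) (R : realType)
    (mu : {measure set T -> \bar R}) : Prop :=
  forall A, ~ atom mu A.

Definition affine2 (R : realType) (a b c : R) (p : R * R) : R :=
  a * p.1 + b * p.2 + c.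

(* For distinct affine functions a non-empty set [l1 = l2] is a line, and it is
   parallel to an axis exactly when it is a horizontal or a vertical line. *)
Definition nondegenerate_pair (R : realType) (l1 l2 : R * R -> R) : Prop :=
  let E := [set p | l1 p = l2 p] in
  [/\ l1 <> l2,
      E !=set0,
      ~ (exists y0 : R, E = [set p | p.2 = y0]) &
      ~ (exists x0 : R, E = [set p | p.1 = x0])].

(* The index set is non-empty, so starting the fold from [F ord0] only repeats
   a member of the family. *)
Definition fmin (R : realType) (n : nat) (F : 'I_n.+1 -> R) : R :=
  \big[Num.min/F ord0]_(j < n.+1) F j.

Definition min_affine (R : realType) (n : nat) (a b c : 'I_n.+1 -> R)
    (p : R * R) : R :=
  fmin (fun j => affine2 (a j) (b j) (c j) p).

Definition is_minimum (R : realType) (A : set R) (m : R) : Prop :=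
  A m /\ lbound A m.

(* The sigma-algebra on the product type is the product of the Borel ones,
   i.e. the Borel sigma-algebra of the plane. *)
Definition transport_plan (R : realType)
    (mu nu : probability (measurableTypeR R) R)
    (pi : probability (measurableTypeR R * measurableTypeR R)%type R) : Prop :=
  forall A : set (measurableTypeR R), measurable A ->
    pi (fst @^-1` A) = mu A /\ pi (snd @^-1` A) = nu A.

Definition interval_decomposition (R : realType) (k : nat)
    (I : 'I_k -> set R) : Prop :=
  [/\ \bigcup_i I i = setT, trivIset setT I,
      forall i, I i !=set0 & forall i, connected (I i)].

Definition mpartition (R : realType)
    (mu nu : probability (measurableTypeR R) R) (k : nat)
    (I J : 'I_k -> set R) : Prop :=
  [/\ interval_decomposition I, interval_decomposition J &
      forall i, mu (I i) = nu (J i) /\ (0 < mu (I i))%E].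

Definition partition_cost (R : realType)
    (mu nu : probability (measurableTypeR R) R) (n : nat)
    (a b c : 'I_n.+1 -> R) (k : nat) (I J : 'I_k -> set R) : R :=
  \sum_(i < k) fmin (fun j => a j * (\int[mu]_(x in I i) x)
                            + b j * (\int[nu]_(y in J i) y)
                            + c j * fine (mu (I i))).

(* Main.v *)
Require Import Defs.
From HB Require Import structures.
From mathcomp Require Import all_boot all_order all_algebra.
From mathcomp Require Import all_classical all_reals all_analysis.
From mathcomp Require Import measurable_realfun ring lra.
Import Order.TTheory GRing.Theory Num.Theory.
Import numFieldNormedType.Exports.

Local Open Scope classical_set_scope.
Local Open Scope ring_scope.

(* Given a plan pi, cut the plane into the cells where the j-th affine function
   is the first one attaining the minimum c, and keep only the masses m_j of
   these cells.  Among all ways of splitting mu into pieces of masses m_j, the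
   sum of the a_j \int x is smallest when the line is cut into consecutive
   intervals in decreasing order of the a_j (Abel summation reduces this to the
   bathtub principle), and likewise for nu and the b_j.  So \int c dpi is at
   least a function of m alone, which is continuous on the simplex and hence
   has a minimizer.  The interval partition built from the minimizer costs at
   most this minimum.  Conversely every partition yields the plan
   \sum_i (mu|I_i x nu|J_i) / mu(I_i), which costs no more than the partition,
   so both minima equal the minimum over the simplex. *)

Set Implicit Arguments.
Unset Strict Implicit.
Unset Printing Implicit Defensive.

(** * Abel summation over superlevel sets *)

(** The inequality is strict so that, at [theta = a i], this is the total of [d] over the indices
    preceding [i] in decreasing order of [a]; no sorting permutation is needed. *)
Definition upper_sum (R : realType) (I : finType) (a d : I -> R) (theta : R) :=
  \sum_(i | theta < a i) d i.

(** Induction on the number of indices above the threshold: raising [theta] to the lowest value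
    [a i] above it removes exactly [i], since [a] is injective. *)
Lemma upper_sum_ind (R : realType) (I : finType) (a : I -> R) (P : R -> Prop) :
  injective a ->
  (forall theta, (forall i, a i <= theta) -> P theta) ->
  (forall theta i, theta < a i ->
     (forall j, (theta < a j) = (j == i) || (a i < a j)) -> P (a i) -> P theta) ->
  forall theta, P theta.
Proof.
move=> a_inj P0 PS theta; have [k] := ubnP #|[pred i | theta < a i]|.
elim: k theta => // k IH theta lek.
have [/existsP[i0 hi0]|/existsPn h] := boolP [exists i, theta < a i]; last first.
  by apply: P0 => i; rewrite leNgt h.
case: (@Order.TotalTheory.arg_minP _ _ _ i0 [pred i | theta < a i] a hi0) => i hi imin.
have cutE j : (theta < a j) = (j == i) || (a i < a j).
  apply/idP/orP => [hj|[/eqP->//|/(lt_trans hi)//]].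
  have [->|ji] := eqVneq j i; [by left|right].
  by rewrite lt_neqAle imin// andbT; apply: contra ji => /eqP/a_inj->.
apply: (PS _ i) => //; apply: IH; rewrite -ltnS; apply: leq_trans lek.
rewrite ltnS; apply: proper_card; apply/properP; split.
  by apply/fintype.subsetP => j; rewrite !inE cutE orbC => ->.
by exists i; rewrite inE ?ltxx.
Qed.

Lemma upper_sum_cut (R : realType) (I : finType) (a d : I -> R) theta i :
  (forall j, (theta < a j) = (j == i) || (a i < a j)) ->
  upper_sum a d theta = d i + upper_sum a d (a i).
Proof.
move=> cutE; rewrite /upper_sum (bigD1 i) ?cutE ?eqxx//=; congr (_ + _).
apply: eq_bigl => j; rewrite cutE; have [->|] := eqVneq j i; first by rewrite ltxx.
by rewrite andbT.
Qed.

(** In decreasing order of [a], the summands are increments of [G] over adjacent intervals, the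
    first of which starts at 0. *)
Lemma telescope_upper_sum (R : realType) (I : finType) (a m : I -> R) (G : R -> R) :
  injective a -> G 0 = 0 -> forall theta,
  upper_sum a (fun i => G (upper_sum a m (a i) + m i) - G (upper_sum a m (a i)))
    theta = G (upper_sum a m theta).
Proof.
move=> a_inj G0; apply: (upper_sum_ind a_inj) => [theta h|theta i hi cutE IH].
  by rewrite /upper_sum !big_pred0 ?G0// => i; rewrite ltNge h.
rewrite (upper_sum_cut _ cutE) IH.
by rewrite [in RHS](upper_sum_cut _ cutE) subrK addrC.
Qed.

(** Lowering the threshold from [a i] to the next value [theta] adds
    [(a i - theta) * upper_sum a d theta], a product of non-negative factors. *)
Lemma abel_upper_sum (R : realType) (I : finType) (a d : I -> R) :
  injective a -> (forall theta, 0 <= upper_sum a d theta) ->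
  forall theta, 0 <= \sum_(i | theta < a i) (a i - theta) * d i.
Proof.
move=> a_inj d_ge0; apply: (upper_sum_ind a_inj) => [theta h|theta i hi cutE IH].
  by rewrite big_pred0// => i; rewrite ltNge h.
have -> : \sum_(j | theta < a j) (a j - theta) * d j =
    \sum_(j | a i < a j) (a j - a i) * d j + (a i - theta) * upper_sum a d theta.
  have -> : \sum_(j | a i < a j) (a j - a i) * d j =
      \sum_(j | theta < a j) (a j - a i) * d j.
    rewrite [RHS](bigD1 i)//= subrr mul0r add0r; apply: eq_bigl => j.
    rewrite cutE; have [->|] := eqVneq j i; first by rewrite ltxx.
    by rewrite andbT.
  rewrite /upper_sum mulr_sumr -big_split/=; apply: eq_bigr => j _; ring.
by rewrite addr_ge0// mulr_ge0// subr_ge0 ltW.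
Qed.

(** Supplies a threshold at which an upper sum runs over all indices. *)
Lemma finite_lower_bound (R : realType) (I : finType) (a : I -> R) :
  exists L, forall i, L < a i.
Proof.
exists (- \sum_i `|a i| - 1) => i.
have : `|a i| <= \sum_i `|a i| by rewrite (bigD1 i)//= lerDl sumr_ge0.
by have := ler_norm (- a i); rewrite normrN; lra.
Qed.

Lemma upper_sum_total (R : realType) (I : finType) (a d : I -> R) L :
  (forall i, L < a i) -> upper_sum a d L = \sum_i d i.
Proof. by move=> La; apply: eq_bigl. Qed.

(** Since the [d i] sum to zero, replacing [a i] by [a i - L] does not change the sum. *)
Lemma abel_sum_ge0 (R : realType) (I : finType) (a d : I -> R) :
  injective a -> (forall theta, 0 <= upper_sum a d theta) ->
  \sum_i d i = 0 -> 0 <= \sum_i a i * d i.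
Proof.
move=> a_inj d_ge0 d0; have [L La] := finite_lower_bound a.
have := abel_upper_sum a_inj d_ge0 L.
rewrite (eq_bigl _ _ La); under eq_bigr do rewrite mulrBl.
by rewrite sumrB -mulr_sumr d0 mulr0 subr0.
Qed.

(** * Integration *)

Section integration.
Context d (T : measurableType d) (R : realType).

Lemma Rintegral_eq_null (mu : {measure set T -> \bar R}) (A B : set T) (f : T -> R) :
  measurable A -> measurable B -> mu.-integrable setT (EFin \o f) ->
  mu (A `\` B) = 0%E -> mu (B `\` A) = 0%E ->
  \int[mu]_(x in A) f x = \int[mu]_(x in B) f x.
Proof.
move=> mA mB fi AB0 BA0; rewrite /Rintegral; congr fine.
rewrite (@negligible_integral _ _ _ mu A (A `\` B))//; last first.
- exact: integrableS fi.
- exact: measurableD.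
rewrite [RHS](@negligible_integral _ _ _ mu B (B `\` A))//; last first.
- exact: integrableS fi.
- exact: measurableD.
by rewrite !setDD setIC.
Qed.

Lemma Rintegral_bigsetU (mu : {measure set T -> \bar R}) (I : finType) (P : pred I)
    (D : I -> set T) (f : T -> R) :
  (forall i, measurable (D i)) -> trivIset setT D ->
  mu.-integrable setT (EFin \o f) ->
  \int[mu]_(x in \big[setU/set0]_(i | P i) D i) f x = \sum_(i | P i) \int[mu]_(x in D i) f x.
Proof.
move=> mD tD fi.
have fin i : (\int[mu]_(x in D i) (f x)%:E)%E \is a fin_num.
  by apply: integrable_fin_num => //; exact: integrableS fi.
rewrite /Rintegral -big_filter integral_bigsetU_EFin//.
- rewrite big_filter; under eq_bigr do rewrite -(fineK (fin _)).
  by rewrite sumEFin.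
- exact: filter_uniq (index_enum_uniq I).
- exact: sub_trivIset tD.
- apply: measurable_funS (measurable_int _ fi) => //.
Qed.

Lemma fine_measure_bigsetU (mu : {finite_measure set T -> \bar R}) (I : finType)
    (P : pred I) (D : I -> set T) :
  (forall i, measurable (D i)) -> trivIset setT D ->
  fine (mu (\big[setU/set0]_(i | P i) D i)) = \sum_(i | P i) fine (mu (D i)).
Proof.
move=> mD tD; rewrite -[LHS]mul1r -Rintegral_cst; last exact: bigsetU_measurable.
rewrite Rintegral_bigsetU//; last exact: finite_measure_integrable_cst.
by apply: eq_bigr => i _; rewrite Rintegral_cst// mul1r.
Qed.

(** [X - q] is non-positive on [A] and non-negative off [A], so its restriction to [A] lies
    pointwise below its restriction to [S]. Equal masses make the shift by [q] cancel. *)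
Lemma bathtub (P : probability T R) (X : T -> R) (q : R) (A S : set T) :
  measurable A -> measurable S -> P.-integrable setT (EFin \o X) ->
  fine (P A) = fine (P S) -> (forall p, A p -> X p <= q) -> (forall p, ~ A p -> q <= X p) ->
  \int[P]_(p in A) X p <= \int[P]_(p in S) X p.
Proof.
move=> mA mS Xi PAS Aq Sq.
have Xqi : P.-integrable setT (EFin \o (fun p => X p - q)).
  exact: (integrableB measurableT Xi (finite_measure_integrable_cst P q measurableT)).
suff : \int[P]_(p in A) (X p - q) <= \int[P]_(p in S) (X p - q).
  have shift B : measurable B ->
      \int[P]_(p in B) (X p - q) = \int[P]_(p in B) X p - q * fine (P B).
    move=> mB; rewrite RintegralB//; first by rewrite Rintegral_cst.
      exact: (integrableS measurableT mB _ Xi).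
    exact: finite_measure_integrable_cst.
  by rewrite !shift// PAS lerD2r.
have restr_int B : measurable B ->
    P.-integrable setT (EFin \o ((fun p => X p - q) \_ B)).
  move=> mB; rewrite -restrict_EFin; apply/(integrable_mkcond _ mB).
  exact: (integrableS measurableT mB _ Xqi).
rewrite !(Rintegral_mkcond _ _ (fun p => X p - q)); apply: le_Rintegral => //.
- exact: restr_int mA.
- exact: restr_int mS.
- move=> p _; rewrite !patchE; case: ifPn => [/set_mem Ap|/negP nAp]; case: ifPn => // _.
  + by rewrite subr_le0 Aq.
  + by rewrite subr_ge0 Sq// => /mem_set.
Qed.

End integration.

(** * Distribution functions *)

Definition rcdf (R : realType) (mu : probability (measurableTypeR R) R) (x : R) : R :=
  fine (mu `]-oo, x]%classic).

(** Plays the role of the half-line left of the [t]-quantile, without choosing a quantile where the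
    cdf is flat. *)
Definition sublevel (R : realType) (mu : probability (measurableTypeR R) R) (t : R) :
    set (measurableTypeR R) := [set x | rcdf mu x <= t].

Section rcdf.
Context (R : realType) (mu : probability (measurableTypeR R) R).
Notation F := (rcdf mu).

Lemma mu_rcdf x : mu `]-oo, x]%classic = (F x)%:E.
Proof. by rewrite fineK// fin_num_measure. Qed.

Lemma rcdf_ge0 x : 0 <= F x.
Proof. by rewrite fine_ge0. Qed.

Lemma rcdf_le1 x : F x <= 1.
Proof. by rewrite -lee_fin -mu_rcdf probability_le1. Qed.

Lemma rcdf_le x y : x <= y -> F x <= F y.
Proof.
move=> xy; rewrite -lee_fin -!mu_rcdf le_measure ?inE//.
by apply: subset_itvl; rewrite bnd_simp.
Qed.

Lemma measurable_sublevel t :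
  measurable (sublevel mu t).
Proof.
apply: is_interval_measurable => x y _ Fy z /andP[_ zy].
exact: le_trans (rcdf_le zy) Fy.
Qed.

Lemma mu_bigcup_le (E : (set (measurableTypeR R))^nat) t :
  (forall n, measurable (E n)) -> nondecreasing_seq E ->
  (forall n, (mu (E n) <= t)%E) -> (mu (\bigcup_n E n) <= t)%E.
Proof.
move=> mE ndE Et.
have cE := @nondecreasing_cvg_mu _ _ _ mu _ mE (bigcupT_measurable _ mE) ndE.
by apply: (cvge_le _ cE); apply: nearW.
Qed.

Lemma mu_bigcap_ge (E : (set (measurableTypeR R))^nat) t :
  (forall n, measurable (E n)) -> nonincreasing_seq E ->
  (forall n, (t <= mu (E n))%E) -> (t <= mu (\bigcap_n E n))%E.
Proof.
move=> mE ndE Et.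
have cE : mu \o E @ \oo --> mu (\bigcap_n E n).
  apply: nonincreasing_cvg_mu => //; last exact: bigcapT_measurable.
  by rewrite -ge0_fin_numE// fin_num_measure.
by apply: (cvge_ge _ cE); apply: nearW.
Qed.

Hypothesis mu_atomless : atomless mu.

Lemma atomless_set1 x : mu [set x] = 0%E.
Proof.
apply/eqP; apply: contraPT (mu_atomless (A := [set x])) => mux0 h; apply: h; split => //.
- by rewrite lt0e mux0/=.
- move=> B mB /subset_set1[->|->]; first by left.
  by right.
Qed.

(** The set is closed downwards. If it is neither empty nor the whole line, it ends at a finite [q],
    and limits of the cdf from the left and from the right of [q] bound its mass by [t] on both
    sides. In the two extreme cases the limits at minus and plus infinity force [t = 0] or
    [t = 1]. *)
Lemma mu_sublevel t : 0 <= t <= 1 -> mu (sublevel mu t) = t%:E.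
Proof.
move=> /andP[t0 t1]; set D := sublevel mu t.
have mD : measurable D := measurable_sublevel t.
have Ddown x y : D y -> x <= y -> D x.
  by move=> Dy xy; exact: le_trans (rcdf_le xy) Dy.
have [D0|/set0P[x0 Dx0]] := eqVneq D set0.
  have : (t%:E <= mu (\bigcap_n `]-oo, (- n%:R : R)%R]%classic))%E.
    apply: mu_bigcap_ge => // [m n mn|n].
      apply/subsetPset => x/=; rewrite !in_itv/= => /le_trans; apply.
      by rewrite lerN2 ler_nat.
    rewrite mu_rcdf lee_fin leNgt; apply/negP => /ltW Dn.
    by have : D (- n%:R) by []; rewrite D0.
  rewrite (_ : \bigcap_n _ = set0) ?measure0 ?lee_fin => [t_le0|]; last first.
    rewrite -subset0 => x /(_ (Num.bound x) I).
    by rewrite /= in_itv/= leNgt => /negP; apply; rewrite ltrNl unstable.ltrNbound.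
  by rewrite D0 measure0; congr EFin; apply/eqP; rewrite eq_le t0.
have [DT|/setTPn[y0 Dy0]] := eqVneq D setT.
  have : (mu (\bigcup_n `]-oo, (n%:R : R)%R]%classic) <= t%:E)%E.
    apply: mu_bigcup_le => // [m n mn|n].
      apply/subsetPset => x/=; rewrite !in_itv/= => /le_trans; apply.
      by rewrite ler_nat.
    by rewrite mu_rcdf lee_fin; have : D n%:R by rewrite DT.
  rewrite (_ : \bigcup_n _ = setT) ?probability_setT ?lee_fin => [t_ge1|]; last first.
    rewrite -subTset => x _; exists (Num.bound x) => //=.
    by rewrite in_itv/= ltW// unstable.ltr_bound.
  by rewrite DT probability_setT; congr EFin; apply/eqP; rewrite eq_le t1 t_ge1.
have supD : has_sup D.
  split; first by exists x0.
  exists y0 => x Dx; rewrite leNgt; apply/negP => /ltW /(Ddown _ _ Dx).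
  exact: Dy0.
pose q := sup D.
have Dlt x : x < q -> D x.
  move=> xq; have [|y Dy] := @sup_adherent _ D (q - x) _ supD.
    by rewrite subr_gt0.
  by rewrite subKr => /ltW; exact: Ddown.
have Dgt x : q < x -> t < F x.
  by move=> qx; rewrite ltNge; apply/negP => /(ub_le_sup supD.2); rewrite leNgt qx.
have oo_oc : mu `]-oo, q]%classic = mu `]-oo, q[%classic.
  rewrite -(@setUitv1 _ _ -oo%O q true)// measureU0//; exact: atomless_set1.
have muq : mu `]-oo, q]%classic = t%:E.
  apply/eqP; rewrite eq_le; apply/andP; split.
    rewrite oo_oc.
    have -> : `]-oo, q[%classic = \bigcup_n `]-oo, q - n.+1%:R^-1]%classic.
      apply/seteqP; split => [x|x [n _]] /=; rewrite !in_itv/=.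
        move=> /ltr_add_invr[n nx].
        by exists n => //=; rewrite in_itv/= lerBrDr ltW.
      by move=> /le_lt_trans; apply; rewrite ltrBlDr ltrDl.
    apply: mu_bigcup_le => // [m n mn|n].
      apply/subsetPset => x/=; rewrite !in_itv/= => /le_trans; apply.
      by rewrite lerD2l lerN2 lef_pV2 ?posrE// ler_nat.
    by rewrite mu_rcdf lee_fin; apply: Dlt; rewrite ltrBlDr ltrDl.
  rewrite (itvNycEbigcap false); apply: mu_bigcap_ge => // [m n mn|n].
    apply/subsetPset => x/=; rewrite !in_itv/= => /le_trans; apply.
    by rewrite lerD2l lef_pV2 ?posrE// ler_nat.
  by rewrite mu_rcdf lee_fin ltW// Dgt// ltrDl.
(* The set lies between the open and the closed half-line ending at [q], which have equal mass
   because points are null. *)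
apply/eqP; rewrite eq_le -muq; apply/andP; split.
  rewrite le_measure ?inE// => x Dx /=.
  by rewrite in_itv/=; exact: (ub_le_sup supD.2).
by rewrite oo_oc le_measure ?inE// => x /=; rewrite in_itv/=; exact: Dlt.
Qed.

Lemma fine_mu_sublevel t : 0 <= t <= 1 -> fine (mu (sublevel mu t)) = t.
Proof. by move=> t01; rewrite mu_sublevel. Qed.

End rcdf.

(** * Change of variables for random variables with a given law *)

Section law.
Context d (T : measurableType d) (R : realType).
Context (P : probability T R) (mu : probability (measurableTypeR R) R).
Variable X : T -> measurableTypeR R.
Hypotheses (mX : measurable_fun setT X)
  (lawX : forall A : set (measurableTypeR R), measurable A -> P (X @^-1` A) = mu A).

Lemma integral_law (D : set (measurableTypeR R)) (f : measurableTypeR R -> \bar R) :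
  measurable D ->
  (\int[pushforward P X]_(x in D) f x = \int[mu]_(x in D) f x)%E.
Proof. by move=> mD; apply: eq_measure_integral => A mA _; exact: lawX. Qed.

Hypothesis moment : mu.-integrable setT (fun x : R => x%:E).

Lemma integrable_law : P.-integrable setT (EFin \o X).
Proof.
apply/integrableP; split; first exact/measurable_EFinP.
have /integrableP[mid] := moment; apply: le_lt_trans.
rewrite -integral_law// ge0_integral_pushforward//.
by apply: measurableT_comp => //; exact: measurable_int moment.
Qed.

Lemma Rintegral_law (D : set (measurableTypeR R)) :
  measurable D -> \int[P]_(p in X @^-1` D) X p = \int[mu]_(x in D) (x : R).
Proof.
move=> mD; have XD : measurable (X @^-1` D) by rewrite -[_ @^-1` _]setTI; exact: mX.
rewrite /Rintegral -integral_law// integral_pushforward//.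
exact: (integrableS measurableT XD _ integrable_law).
Qed.

End law.

(** For atomless [mu] and [t] in [0, 1] this is the integral of the quantile function over [0, t],
    that is, the generalized Lorenz curve. *)
Definition lower_moment (R : realType) (mu : probability (measurableTypeR R) R) (t : R) : R :=
  \int[mu]_(x in sublevel mu t) (x : R).

Section lower_moment.
Context (R : realType) (mu : probability (measurableTypeR R) R).
Hypotheses (mu_atomless : atomless mu)
  (moment : mu.-integrable setT (fun x : R => x%:E)).
Notation F := (rcdf mu).
Notation D := (sublevel mu).

Lemma lower_moment0 : lower_moment mu 0 = 0.
Proof.
have mD := measurable_sublevel mu 0.
rewrite /lower_moment (@Rintegral_eq_null _ _ _ mu _ set0)//.
- by rewrite Rintegral_set0.
- by rewrite setD0; apply: mu_sublevel => //; rewrite lexx ler01.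
- by rewrite set0D measure0.
Qed.

Lemma measurable_slab s t : measurable (D t `\` D s).
Proof. by apply: measurableD; exact: measurable_sublevel. Qed.

Lemma lower_momentB s t : s <= t ->
  lower_moment mu t - lower_moment mu s = \int[mu]_(x in D t `\` D s) (x : R).
Proof.
move=> st; have DsDt : D s `<=` D t by move=> x /le_trans; exact.
rewrite /lower_moment -{1}(setDUK DsDt) Rintegral_setU//.
- by rewrite addrC addKr.
- exact: measurable_sublevel.
- exact: measurable_slab.
- rewrite setDUK//; apply: integrableS moment => //.
  exact: measurable_sublevel.
- by apply/disj_setPS => x [? []].
Qed.

Lemma fine_mu_slab s t : s <= t ->
  fine (mu (D t `\` D s)) = fine (mu (D t)) - fine (mu (D s)).
Proof.
move=> st; have mD u : measurable (D u) by exact: measurable_sublevel.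
rewrite measureD//; last by rewrite -ge0_fin_numE// fin_num_measure.
have -> : D t `&` D s = D s by apply/setIidPr => x /le_trans; exact.
by rewrite fineB// fin_num_measure.
Qed.

(** Covering all real [t] lets continuity of [lower_moment] be proved on the whole line. *)
Lemma fine_mu_sublevel_clamp t : fine (mu (D t)) = Num.max 0 (Num.min t 1).
Proof.
have [t0|t0] := ltP t 0.
  rewrite (_ : D t = set0) ?measure0/=.
    by rewrite (min_idPl _) ?(max_idPl _) ?ltW// (lt_trans t0).
  by rewrite -subset0 => x /= /le_lt_trans /(_ t0); rewrite ltNge rcdf_ge0.
rewrite (max_idPr _); last by rewrite le_min t0 ler01.
have [t1|t1] := leP t 1; first by rewrite fine_mu_sublevel ?t0.
rewrite (_ : D t = setT) ?probability_setT// -subTset => x _ /=.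
exact: le_trans (rcdf_le1 _ _) (ltW t1).
Qed.

Lemma fine_mu_slab_le s t : s <= t -> fine (mu (D t `\` D s)) <= t - s.
Proof.
move=> st; rewrite fine_mu_slab// !fine_mu_sublevel_clamp.
have [] := leP s 1; have [] := leP t 1 => ? ?; rewrite ?(max_r ler01).
all: have [] := leP 0 s; have [] := leP 0 t => ? ?; lra.
Qed.

(** The slab between levels [s <= t] has mass at most [t - s], so absolute continuity of the
    integral applies. *)
Lemma continuous_lower_moment : continuous (lower_moment mu).
Proof.
have close e : 0 < e -> exists2 r : R, 0 < r &
    forall s t, s <= t -> t - s < r -> `|lower_moment mu t - lower_moment mu s| < e.
  move=> e0; have [r [r0 small]] := integral_normr_continuous moment e0.
  exists r => // s t st tsr; rewrite lower_momentB//.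
  have mS := measurable_slab s t.
  have slab_lt : (mu (D t `\` D s) < r%:E)%E.
    rewrite -(fineK (fin_num_measure mu _ mS)) lte_fin.
    exact: le_lt_trans (fine_mu_slab_le st) tsr.
  apply: le_lt_trans (small _ mS slab_lt).
  exact: (le_normr_Rintegral mS (integrableS measurableT mS _ moment)).
move=> t; apply/cvgrPdist_lt => e /close[r r0 small].
near=> s; have : `|t - s| < r by near: s; exact: cvgr_dist_lt.
have [st|/ltW ts] := leP s t; first by rewrite ger0_norm ?subr_ge0// => /small; exact.
by rewrite distrC ger0_norm ?subr_ge0// distrC => /small; exact.
Unshelve. all: by end_near. Qed.

End lower_moment.
(** * Rearrangement *)

(* With F the cdf, the slab [s_i < F x <= s_i + m_i], where s_i is the total mass
   of the indices j with a_j > a_i, is the interval of mass m_i when the line is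
   filled from left to right in decreasing order of a. *)
Definition sorted_cost (R : realType) (mu : probability (measurableTypeR R) R)
    (I : finType) (a m : I -> R) : R :=
  \sum_i a i * (lower_moment mu (upper_sum a m (a i) + m i) -
                lower_moment mu (upper_sum a m (a i))).

Section rearrangement.
Context d (T : measurableType d) (R : realType).
Context (P : probability T R) (mu : probability (measurableTypeR R) R).
Variable X : T -> measurableTypeR R.
Hypotheses (mX : measurable_fun setT X)
  (lawX : forall A : set (measurableTypeR R), measurable A -> P (X @^-1` A) = mu A).
Hypotheses (mu_atomless : atomless mu)
  (moment : mu.-integrable setT (fun x : R => x%:E)).

Lemma lower_moment1 : lower_moment mu 1 = \int[mu]_x (x : R).
Proof.
rewrite /lower_moment (_ : sublevel mu 1 = setT)// -subTset => x _.
exact: rcdf_le1.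
Qed.

(** The bathtub principle, with the supremum of the sublevel set as threshold. If that set is empty
    or the whole line there is no finite threshold, but then [S] is null or of full measure. *)
Lemma lower_moment_le (S : set T) : measurable S ->
  lower_moment mu (fine (P S)) <= \int[P]_(p in S) X p.
Proof.
move=> mS; set t := fine (P S).
have t01 : 0 <= t <= 1.
  rewrite fine_ge0//= -lee_fin fineK ?fin_num_measure//.
  exact: probability_le1.
have mD := measurable_sublevel mu t.
set A := X @^-1` sublevel mu t.
have mA : measurable A by rewrite -[A]setTI; exact: mX.
have PA : P A = P S.
  by rewrite lawX// mu_sublevel// /t fineK// fin_num_measure.
have Xi := integrable_law mX lawX moment.
rewrite /lower_moment -(Rintegral_law mX lawX moment mD) -/A.
have [D0|/set0P[x0 Dx0]] := eqVneq (sublevel mu t) set0.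
  have A0 : A = set0 by rewrite /A D0 preimage_set0.
  have PS : P S = 0%E by rewrite -PA A0 measure0.
  by rewrite (@Rintegral_eq_null _ _ _ P A S)// A0 ?set0D ?setD0 ?measure0.
have [DT|/setTPn[y0 Dy0]] := eqVneq (sublevel mu t) setT.
  have AT : A = setT by rewrite /A DT preimage_setT.
  have PSC : P (~` S) = 0%E.
    by rewrite probability_setC// -PA AT probability_setT subee.
  by rewrite (@Rintegral_eq_null _ _ _ P A S)// AT ?setTD ?setDT ?measure0.
have supD : has_sup (sublevel mu t).
  split; first by exists x0.
  exists y0 => x Dx; rewrite leNgt; apply/negP => /ltW /(rcdf_le mu) yx.
  by apply: Dy0; exact: le_trans yx Dx.
apply: (@bathtub _ _ _ P X (sup (sublevel mu t))) => //.
- by rewrite PA.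
- by move=> p Ap; exact: (ub_le_sup supD.2).
- move=> p nAp; apply: ge_sup; first by exists x0.
  move=> x Dx; rewrite leNgt; apply/negP => /ltW /(rcdf_le mu) px.
  by apply: nAp; exact: le_trans px Dx.
Qed.

(** Abel summation for the differences between the integrals over the [D i] and the slab integrals.
    Their upper sums telescope to the comparison in [lower_moment_le] for a union of cells, and
    their total vanishes because both families sum to the mean of [mu]. *)
Lemma sorted_cost_le (I : finType) (a : I -> R) (D : I -> set T) :
  injective a -> (forall i, measurable (D i)) -> trivIset setT D ->
  \big[setU/set0]_i D i = setT ->
  sorted_cost mu a (fun i => fine (P (D i))) <= \sum_i a i * \int[P]_(p in D i) X p.
Proof.
move=> a_inj mD tD coverD; rewrite -subr_ge0 /sorted_cost -sumrB.
set m := fun i => fine (P (D i)).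
have Xi := integrable_law mX lawX moment.
have H0 := lower_moment0 mu_atomless moment.
under eq_bigr do rewrite -mulrBr.
apply: abel_sum_ge0 => // [theta|].
  rewrite /upper_sum sumrB subr_ge0.
  rewrite -/(upper_sum a (fun i => lower_moment mu (upper_sum a m (a i) + m i) -
                lower_moment mu (upper_sum a m (a i))) theta) telescope_upper_sum//.
  rewrite -(@Rintegral_bigsetU _ _ _ P _ _ D X)// /upper_sum -(@fine_measure_bigsetU _ _ _ P)//.
  by apply: lower_moment_le; exact: bigsetU_measurable.
have sum_m : \sum_i m i = 1.
  rewrite -(@fine_measure_bigsetU _ _ _ P)// coverD.
  exact: (congr1 fine (@probability_setT _ _ _ P)).
have [L La] := finite_lower_bound a.
rewrite sumrB -(@Rintegral_bigsetU _ _ _ P _ _ D X)// coverD.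
rewrite -(upper_sum_total _ La) telescope_upper_sum// (upper_sum_total _ La).
rewrite sum_m lower_moment1.
by rewrite -(Rintegral_law mX lawX moment measurableT) preimage_setT subrr.
Qed.

End rearrangement.

(** The least cost compatible with cell masses [m] when the two coordinates are arranged
    independently of each other. *)
Definition mass_cost (R : realType) (mu nu : probability (measurableTypeR R) R)
    (I : finType) (a b c m : I -> R) : R :=
  sorted_cost mu a m + sorted_cost nu b m + \sum_i c i * m i.

(** * Minimization over the simplex of masses *)

Lemma continuous_sumr (T : topologicalType) (R : realType) (I : finType)
    (P : pred I) (f : I -> T -> R) :
  (forall i, P i -> continuous (f i)) -> continuous (fun x => \sum_(i | P i) f i x).
Proof. by move=> cf; apply: continuous_big => //; exact: add_continuous. Qed.

(** Extreme value theorem on the simplex, seen among row vectors as a compact box cut by a closed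
    hyperplane. *)
Lemma simplex_min (R : realType) (n : nat) (f : ('I_n.+1 -> R) -> R) :
  continuous (fun v : 'rV[R]_n.+1 => f (v ord0)) ->
  exists m, [/\ forall i, 0 <= m i, \sum_i m i = 1 &
    forall m', (forall i, 0 <= m' i) -> \sum_i m' i = 1 -> f m <= f m'].
Proof.
move=> cf.
pose box := [set v : 'rV[R]_n.+1 | forall i, `[0, 1]%classic (v ord0 i)].
pose plane := (fun v : 'rV[R]_n.+1 => \sum_i v ord0 i) @^-1` [set 1].
have compact_simplex : compact (box `&` plane).
  apply: compact_closedI.
    exact: (@rV_compact R n.+1 (fun=> `[0, 1]%classic) (fun=> @segment_compact R 0 1)).
  apply: preimage_closed; last exact: closed_eq.
  by move=> v _; apply: continuous_sumr => i _; exact: coord_continuous.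
have simplexP (m : 'I_n.+1 -> R) : (forall i, 0 <= m i) -> \sum_i m i = 1 ->
    (box `&` plane) (\row_i m i).
  move=> m0 m1; split => [i|]; last by rewrite /plane/=; under eq_bigr do rewrite mxE.
  by rewrite /= mxE in_itv/= m0 -m1 (bigD1 i)//= lerDl sumr_ge0.
have [|v] := compact_EVT_min _ compact_simplex (continuous_subspaceT cf).
  (* A vertex shows that the simplex is non-empty. *)
  exists (\row_i (i == ord0)%:R); apply: simplexP => [i|]; first by rewrite ler0n.
  by rewrite (bigD1 ord0)//= big1 ?addr0// => i /negbTE ->.
rewrite inE => -[boxv planev] vmin; exists (v ord0); split => //.
  by move=> i; have := boxv i; rewrite /= in_itv/= => /andP[].
move=> m m0 m1; have := vmin (\row_i m i); rewrite inE => /(_ (simplexP _ m0 m1)).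
by congr (_ <= f _); apply/funext => i; rewrite mxE.
Qed.

Lemma continuous_sorted_cost (T : topologicalType) (R : realType) (I : finType)
    (mu : probability (measurableTypeR R) R) (a : I -> R) (m : T -> I -> R) :
  atomless mu -> mu.-integrable setT (fun x : R => x%:E) ->
  (forall i, continuous (fun v => m v i)) ->
  continuous (fun v => sorted_cost mu a (m v)).
Proof.
move=> mu_atomless moment cm; apply: continuous_sumr => i _ v.
have cH := continuous_lower_moment mu_atomless moment.
have cs : continuous (fun v => upper_sum a (m v) (a i)).
  by apply: continuous_sumr => j _; exact: cm.
apply: cvgMl_tmp; apply: cvgB; last exact: continuous_comp (cs v) (cH _).
apply: (@continuous_comp _ _ _ (fun v => upper_sum a (m v) (a i) + m v i)
  (lower_moment mu)); last exact: cH.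
by apply: cvgD; [exact: cs|exact: cm].
Qed.

Lemma continuous_mass_cost (T : topologicalType) (R : realType) (I : finType)
    (mu nu : probability (measurableTypeR R) R) (a b c : I -> R) (m : T -> I -> R) :
  atomless mu -> mu.-integrable setT (fun x : R => x%:E) ->
  atomless nu -> nu.-integrable setT (fun x : R => x%:E) ->
  (forall i, continuous (fun v => m v i)) ->
  continuous (fun v => mass_cost mu nu a b c (m v)).
Proof.
move=> mu_atomless mu_moment nu_atomless nu_moment cm v.
apply: cvgD; first by apply: cvgD; exact: continuous_sorted_cost.
by apply: continuous_sumr => i _ {}v; apply: cvgMl_tmp; exact: cm.
Qed.

Lemma mass_cost_min (R : realType) (n : nat) (mu nu : probability (measurableTypeR R) R)
    (a b c : 'I_n.+1 -> R) :
  atomless mu -> mu.-integrable setT (fun x : R => x%:E) ->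
  atomless nu -> nu.-integrable setT (fun x : R => x%:E) ->
  exists m, [/\ forall i, 0 <= m i, \sum_i m i = 1 &
    forall m', (forall i, 0 <= m' i) -> \sum_i m' i = 1 ->
    mass_cost mu nu a b c m <= mass_cost mu nu a b c m'].
Proof.
move=> mu_atomless mu_moment nu_atomless nu_moment; apply: simplex_min.
by apply: continuous_mass_cost => // i; exact: coord_continuous.
Qed.

(** * Plans and partitions *)

Lemma fmin_le (R : realType) (n : nat) (F : 'I_n.+1 -> R) i : fmin F <= F i.
Proof. exact: bigmin_le_cond. Qed.

Lemma fmin_attained (R : realType) (n : nat) (F : 'I_n.+1 -> R) : exists i, fmin F = F i.
Proof.
apply: (big_ind (fun x => exists i, x = F i)); first by exists ord0.
- by move=> _ _ [i ->] [j ->]; case: leP => _; [exists i|exists j].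
- by move=> i _; exists i.
Qed.

Lemma le_fmin (R : realType) (n : nat) (F : 'I_n.+1 -> R) x :
  (forall i, x <= F i) -> x <= fmin F.
Proof. by have [i ->] := fmin_attained F. Qed.

Lemma measurable_fmin d (T : measurableType d) (R : realType) (n : nat)
    (f : 'I_n.+1 -> T -> R) :
  (forall i, measurable_fun setT (f i)) ->
  measurable_fun setT (fun p => fmin (f ^~ p)).
Proof.
move=> mf; rewrite /fmin; elim: (index_enum _) => [|i s IH].
  by under eq_fun do rewrite big_nil; exact: mf.
under eq_fun do rewrite big_cons.
exact: measurable_minr.
Qed.

Section first_minimizer.
Context d (T : measurableType d) (R : realType) (n : nat) (f : 'I_n.+1 -> T -> R).
Hypothesis mf : forall i, measurable_fun setT (f i).

(** Ties go to the smallest index, which makes the cells disjoint. *)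
Definition first_minimizer (i : 'I_n.+1) : set T :=
  [set p | f i p = fmin (f ^~ p) /\ forall j : 'I_n.+1, (j < i)%N -> f j p != fmin (f ^~ p)].

Lemma measurable_first_minimizer i : measurable (first_minimizer i).
Proof.
have mE j : measurable [set p | f j p = fmin (f ^~ p)].
  have mg := measurable_funB (mf j) (measurable_fmin mf).
  have := mg measurableT [set 0] (measurable_set1 0); rewrite setTI.
  by congr measurable; apply/seteqP; split => p /= => [/subr0_eq|->]; rewrite ?subrr.
rewrite (_ : first_minimizer i = [set p | f i p = fmin (f ^~ p)] `&`
    \bigcap_(j in [set j : 'I_n.+1 | (j < i)%N]) ~` [set p | f j p = fmin (f ^~ p)]).
  apply: measurableI => //; apply: fin_bigcap_measurable => // j _.
  exact: measurableC.
apply/seteqP; split => p [fi fj]; split => // j ji; last exact/eqP/fj.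
by move/eqP; apply/negP/fj.
Qed.

Lemma trivIset_first_minimizer : trivIset setT first_minimizer.
Proof.
apply/trivIsetP => i j _ _ ij; rewrite -subset0 => p [[pi pi'] [pj pj']].
have [/pj'|/pi'|/val_inj/eqP] := ltngtP i j.
- by rewrite pi eqxx.
- by rewrite pj eqxx.
- by rewrite (negbTE ij).
Qed.

Lemma cover_first_minimizer : \big[setU/set0]_i first_minimizer i = setT.
Proof.
rewrite -subTset => p _; rewrite -bigcup_seq.
have [i0 /esym/eqP hi0] := fmin_attained (f ^~ p).
have [i /eqP hi imin] := @arg_minnP _ i0 (fun i => f i p == fmin (f ^~ p)) val hi0.
exists i; first by rewrite /= mem_index_enum.
split => // j ji; apply: contraTN ji => /imin.
by rewrite -leqNgt.
Qed.

End first_minimizer.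

Section plane.
Context (R : realType).
Notation plane := (measurableTypeR R * measurableTypeR R)%type.
Variable P : probability plane R.
Hypotheses (int1 : P.-integrable setT (fun p : plane => (p.1 : R)%:E))
  (int2 : P.-integrable setT (fun p : plane => (p.2 : R)%:E)).

Lemma integrable_affine2 (a b c : R) :
  P.-integrable setT (fun p : plane => (affine2 a b c p)%:E).
Proof.
exact: (integrableD measurableT
  (integrableD measurableT (integrableZl measurableT a int1) (integrableZl measurableT b int2))
  (finite_measure_integrable_cst P c measurableT)).
Qed.

Lemma Rintegral_affine2 (a b c : R) (E : set plane) : measurable E ->
  \int[P]_(p in E) affine2 a b c p =
  a * \int[P]_(p in E) (p.1 : R) + b * \int[P]_(p in E) (p.2 : R) + c * fine (P E).
Proof.
move=> mE.
have i1 := integrableS measurableT mE (@subsetT _ E) int1.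
have i2 := integrableS measurableT mE (@subsetT _ E) int2.
have ia := integrableZl mE a i1; have ib := integrableZl mE b i2.
have ic := finite_measure_integrable_cst P c mE.
rewrite /affine2 RintegralD//; first by rewrite RintegralD// !RintegralZl// Rintegral_cst.
exact: (integrableD mE ia ib).
Qed.

(** At each point the minimum is one of the functions, so its absolute value is dominated by the sum
    of all their absolute values. *)
Lemma integrable_min_affine (n : nat) (a b c : 'I_n.+1 -> R) :
  P.-integrable setT (fun p : plane => (min_affine a b c p)%:E).
Proof.
pose l i (p : plane) : R := affine2 (a i) (b i) (c i) p.
have li i : P.-integrable setT (EFin \o l i) by exact: integrable_affine2.
have sum_li : P.-integrable setT (fun p => \sum_i `|l i p|%:E)%E.
  by apply: integrable_sum => // i _; exact: integrable_norm (li i).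
have ml : measurable_fun setT (fun p => fmin (l ^~ p)).
  by apply: measurable_fmin => i; apply/measurable_EFinP; exact: measurable_int (li i).
apply: (le_integrable measurableT _ _ sum_li); first exact/measurable_EFinP.
move=> p _; rewrite sumEFin lee_fin (ger0_norm (sumr_ge0 _ _))//.
rewrite /min_affine; have [i ->] := fmin_attained (fun i => affine2 (a i) (b i) (c i) p).
by rewrite (bigD1 i)//= lerDl sumr_ge0.
Qed.

End plane.

Section lower_bound.
Context (R : realType) (mu nu : probability (measurableTypeR R) R).
Hypotheses (mu_atomless : atomless mu) (nu_atomless : atomless nu)
  (mu_moment : mu.-integrable setT (fun x : R => x%:E))
  (nu_moment : nu.-integrable setT (fun y : R => y%:E)).
Notation plane := (measurableTypeR R * measurableTypeR R)%type.
Variable P : probability plane R.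
Hypothesis planP : transport_plan mu nu P.

Lemma plan_integrable1 : P.-integrable setT (fun p : plane => (p.1 : R)%:E).
Proof.
apply: (@integrable_law _ _ _ P mu fst) => //.
by move=> A mA; exact: (planP mA).1.
Qed.

Lemma plan_integrable2 : P.-integrable setT (fun p : plane => (p.2 : R)%:E).
Proof.
apply: (@integrable_law _ _ _ P nu snd) => //.
by move=> A mA; exact: (planP mA).2.
Qed.

(** On the [i]-th first-minimizer cell the cost is the [i]-th affine function, so the integral
    splits into an [x]-part, a [y]-part and a constant part. The first two are bounded by
    rearrangement, applied to each projection. *)
Lemma mass_cost_le_plan (n : nat) (a b c : 'I_n.+1 -> R) :
  injective a -> injective b ->
  exists m, [/\ forall i, 0 <= m i, \sum_i m i = 1 &
    mass_cost mu nu a b c m <= \int[P]_p min_affine a b c p].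
Proof.
move=> a_inj b_inj.
have i1 := plan_integrable1; have i2 := plan_integrable2.
pose l i (p : plane) : R := affine2 (a i) (b i) (c i) p.
have ml i : measurable_fun setT (l i).
  by apply/measurable_EFinP; exact: measurable_int (integrable_affine2 i1 i2 _ _ _).
pose S := first_minimizer l.
have mS i : measurable (S i) := measurable_first_minimizer ml i.
have tS : trivIset setT S := trivIset_first_minimizer (f := l).
have cS : \big[setU/set0]_i S i = setT := cover_first_minimizer l.
exists (fun i => fine (P (S i))); split.
- by move=> i; rewrite fine_ge0.
- rewrite -(@fine_measure_bigsetU _ _ _ P)// cS.
  exact: (congr1 fine (@probability_setT _ _ _ P)).
have -> : \int[P]_p min_affine a b c p = \sum_i (a i * \int[P]_(p in S i) (p.1 : R)
    + b i * \int[P]_(p in S i) (p.2 : R) + c i * fine (P (S i))).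
  rewrite -cS (@Rintegral_bigsetU _ _ _ P _ _ S)//; last exact: integrable_min_affine.
  apply: eq_bigr => i _; rewrite -Rintegral_affine2//.
  by apply: eq_Rintegral => p; rewrite inE => -[].
rewrite !big_split/= lerD2r lerD//.
- apply: (@sorted_cost_le _ _ _ P mu fst) => //.
  by move=> A mA; exact: (planP mA).1.
- apply: (@sorted_cost_le _ _ _ P nu snd) => //.
  by move=> A mA; exact: (planP mA).2.
Qed.

End lower_bound.

(** * The coupling of a partition *)

Lemma measure_partition d (T : measurableType d) (R : realType)
    (mu : {measure set T -> \bar R}) (k : nat) (D : 'I_k -> set T) (A : set T) :
  (forall i, measurable (D i)) -> trivIset setT D -> \bigcup_i D i = setT ->
  measurable A -> (\sum_(i < k) mu (A `&` D i) = mu A)%E.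
Proof.
move=> mD tD cD mA; rewrite -measure_bigsetU_ord//; last exact: trivIset_setIl.
  by rewrite -big_distrr/= -bigcup_seq -[in RHS](setIT A) -cD; congr (mu (_ `&` _));
    apply: eq_bigcupl; split => i //= _; exact: mem_index_enum.
by move=> i; exact: measurableI.
Qed.

Section block_coupling.
Context (R : realType) (mu nu : probability (measurableTypeR R) R) (k : nat).
Notation plane := (measurableTypeR R * measurableTypeR R)%type.
Variables I J : 'I_k.+1 -> set (measurableTypeR R).
Hypotheses (mI : forall i, measurable (I i)) (mJ : forall i, measurable (J i))
  (tI : trivIset setT I) (tJ : trivIset setT J)
  (cI : \bigcup_i I i = setT) (cJ : \bigcup_i J i = setT)
  (muI : forall i, mu (I i) = nu (J i)) (muI_gt0 : forall i, (0 < mu (I i))%E).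

Let mIJ i : measurable (I i `*` J i) := measurableX (mI i) (mJ i).

Let inv_mass_ge0 i : 0 <= (fine (mu (I i)))^-1.
Proof. by rewrite invr_ge0 fine_ge0. Qed.

(** Dividing by [mu (I i)] gives the block total mass [nu (J i) = mu (I i)]. The index passes
    through [inord] because [msum] takes a sequence indexed by naturals. *)
Let block (j : nat) : {measure set plane -> \bar R} :=
  mscale (NngNum (inv_mass_ge0 (inord j))) (mrestr (mu \x nu)%E (mIJ (inord j))).

Definition block_coupling : set plane -> \bar R := msum block k.+1.

HB.instance Definition _ := Measure.on block_coupling.

Lemma block_couplingX A B : measurable A -> measurable B ->
  block_coupling (A `*` B) =
  (\sum_(i < k.+1) ((fine (mu (I i)))^-1)%:E * (mu (A `&` I i) * nu (B `&` J i)))%E.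
Proof.
move=> mA mB; apply: eq_bigr => i _; rewrite /block inord_val.
rewrite [LHS](_ : _ = ((fine (mu (I i)))^-1)%:E *
  (mu \x nu) ((A `*` B) `&` (I i `*` J i)))%E//.
by rewrite -setXI product_measure1E//; exact: measurableI.
Qed.

Let inv_massE i : (((fine (mu (I i)))^-1)%:E * mu (I i) = 1)%E.
Proof.
rewrite -[X in (_ * X)%E]fineK ?fin_num_measure// -EFinM mulVf//.
by rewrite gt_eqF// fine_gt0// muI_gt0 -ge0_fin_numE// fin_num_measure.
Qed.

Lemma block_coupling1 A : measurable A -> block_coupling (A `*` setT) = mu A.
Proof.
move=> mA; rewrite block_couplingX//.
under eq_bigr do rewrite setTI -muI muleCA inv_massE mule1.
by rewrite measure_partition.
Qed.

Lemma block_coupling2 A : measurable A -> block_coupling (setT `*` A) = nu A.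
Proof.
move=> mA; rewrite block_couplingX//.
under eq_bigr do rewrite setTI muleA inv_massE mul1e.
by rewrite measure_partition.
Qed.

Let block_coupling_setT : block_coupling setT = 1%E.
Proof. by rewrite -setXTT block_coupling1// probability_setT. Qed.

HB.instance Definition _ :=
  Measure_isProbability.Build _ _ _ block_coupling block_coupling_setT.

Definition block_plan : probability plane R := block_coupling.

Lemma block_coupling_plan : transport_plan mu nu block_plan.
Proof.
move=> A mA; split.
- by rewrite -block_coupling1//; congr (block_coupling _); apply/seteqP; split => -[x y] //= [].
- by rewrite -block_coupling2//; congr (block_coupling _); apply/seteqP; split => -[x y] //= [].
Qed.

(** With its companion below, this makes the strips over [I i] and over [J i] equal up to a null
    set. *)
Lemma block_coupling_offdiag1 i : block_coupling (I i `*` ~` J i) = 0%E.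
Proof.
rewrite block_couplingX//; last exact: measurableC.
rewrite big1// => j _; have [->|ij] := eqVneq j i.
  by rewrite setICl measure0 !mule0.
by move/trivIsetP : tI => /(_ i j Logic.I Logic.I) ->; rewrite ?measure0 ?mul0e ?mule0// eq_sym.
Qed.

Lemma block_coupling_offdiag2 i : block_coupling (~` I i `*` J i) = 0%E.
Proof.
rewrite block_couplingX//; last exact: measurableC.
rewrite big1// => j _; have [->|ij] := eqVneq j i.
  by rewrite setICl measure0 mul0e mule0.
by move/trivIsetP : tJ => /(_ i j Logic.I Logic.I) ->; rewrite ?measure0 ?mule0// eq_sym.
Qed.

End block_coupling.

Section partition_plan.
Context (R : realType) (mu nu : probability (measurableTypeR R) R).
Hypotheses (mu_moment : mu.-integrable setT (fun x : R => x%:E))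
  (nu_moment : nu.-integrable setT (fun y : R => y%:E)).
Notation plane := (measurableTypeR R * measurableTypeR R)%type.

Lemma measurable_connected (A : set R) : connected A -> measurable (A : set (measurableTypeR R)).
Proof. by move/connected_intervalP; exact: is_interval_measurable. Qed.

(** Over the vertical strip above [I i], the cost is at most each affine function [j], whose
    integral there is the [j]-th candidate in the [i]-th term of the partition cost. *)
Lemma partition_plan (n : nat) (a b c : 'I_n.+1 -> R) (k : nat) (I J : 'I_k -> set R) :
  mpartition mu nu I J ->
  exists P : probability plane R, transport_plan mu nu P /\
    \int[P]_p min_affine a b c p <= partition_cost mu nu a b c I J.
Proof.
case: k I J => [I J [[cI _ _ _] _ _]|k I J].
  (* Order zero is impossible: an empty union does not contain 0. *)
  by have : [set: R] 0 by []; rewrite -cI => -[[]].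
move=> [[cI tI _ conI] [cJ tJ _ conJ] muIJ].
have mI i := measurable_connected (conI i).
have mJ i := measurable_connected (conJ i).
have muI i := (muIJ i).1; have muI_gt0 i := (muIJ i).2.
pose P : probability plane R := block_plan mI mJ tI cI muI muI_gt0.
have planP : transport_plan mu nu P by exact: block_coupling_plan.
exists P; split => //.
have i1 := plan_integrable1 mu_moment planP.
have i2 := plan_integrable2 nu_moment planP.
pose S i : set plane := fst @^-1` (I i).
have mS i : measurable (S i) by rewrite -[S i]setTI; exact: measurable_fst.
have mS' i : measurable (snd @^-1` (J i) : set plane).
  by rewrite -[_ @^-1` _]setTI; exact: measurable_snd.
have tS : trivIset setT S.
  by apply/trivIsetP => i j _ _ ij; rewrite /S -preimage_setI;
    move/trivIsetP : (tI) => ->//; rewrite preimage_set0.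
have cS : \big[setU/set0]_i S i = setT.
  rewrite -subTset => p _; rewrite -bigcup_seq.
  have : [set: R] p.1 by []; rewrite -cI => -[i _ Ip].
  by exists i => //=; exact: mem_index_enum.
rewrite -cS (@Rintegral_bigsetU _ _ _ P _ _ S)//; last exact: integrable_min_affine.
apply: ler_sum => i _; apply: le_fmin => j.
have fst_int : \int[P]_(p in S i) (p.1 : R) = \int[mu]_(x in I i) x.
  by apply: (@Rintegral_law _ _ _ P mu fst) => // A mA; exact: (planP A mA).1.
(* The vertical strip is exchanged for the horizontal one over [J i], at the cost of the null
   off-diagonal sets. *)
have snd_int : \int[P]_(p in S i) (p.2 : R) = \int[nu]_(y in J i) y.
  rewrite -(@Rintegral_law _ _ _ P nu snd)//; last by move=> A mA; exact: (planP A mA).2.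
  apply: Rintegral_eq_null => //.
    rewrite -[RHS](block_coupling_offdiag1 mu nu mI mJ tI i).
    by congr (P _); apply/seteqP; split => -[].
  rewrite -[RHS](block_coupling_offdiag2 mu nu mI mJ tJ i).
  by congr (P _); apply/seteqP; split => -[x y] [].
have -> : mu (I i) = P (S i) by exact/esym/(planP _ (mI i)).1.
rewrite -fst_int -snd_int -Rintegral_affine2//; apply: le_Rintegral => //.
- exact: (integrableS measurableT (mS i) _ (integrable_min_affine i1 i2 a b c)).
- exact: (integrableS measurableT (mS i) _ (integrable_affine2 i1 i2 _ _ _)).
- by move=> p _; exact: (fmin_le (fun j => affine2 (a j) (b j) (c j) p)).
Qed.

End partition_plan.

(** * The interval partition of a mass vector *)

Section upper_sum_steps.
Context (R : realType) (I : finType) (a m : I -> R).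
Hypotheses (a_inj : injective a) (m_ge0 : forall i, 0 <= m i).

Lemma upper_sum_ge0 theta : 0 <= upper_sum a m theta.
Proof. exact: sumr_ge0. Qed.

Lemma upper_sum_step_le theta j : theta < a j ->
  upper_sum a m (a j) + m j <= upper_sum a m theta.
Proof.
move=> hj; rewrite /upper_sum [leRHS](bigD1 j)//= [leLHS]addrC lerD2l.
rewrite big_mkcond [leRHS]big_mkcond; apply: ler_sum => l _.
have [jl|_] := ltP (a j) (a l); last by case: ifP.
rewrite (lt_trans hj jl)/= (_ : l != j)//.
by apply: contraTneq jl => ->; rewrite ltxx.
Qed.

Lemma upper_sum_step_eq theta j : theta < a j ->
  (forall l, theta < a l -> a l < a j -> m l = 0) ->
  upper_sum a m (a j) + m j = upper_sum a m theta.
Proof.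
move=> hj gap; rewrite /upper_sum [RHS](bigD1 j)//= [LHS]addrC; congr (_ + _).
rewrite big_mkcond [RHS]big_mkcond; apply: eq_bigr => l _.
have [->|lj] := eqVneq l j; first by rewrite ltxx andbF.
rewrite andbT; case: (ltgtP (a j) (a l)) => [jl|jl|/a_inj/esym/eqP].
- by rewrite (lt_trans hj jl).
- by case: ifP => // /gap ->.
- by rewrite (negbTE lj).
Qed.

(** Take the lowest index of positive mass above [theta]; those skipped carry no mass. At
    [theta = a i] this finds the cell just left of cell [i]. *)
Lemma upper_sum_next theta : upper_sum a m theta != 0 ->
  exists j, [/\ theta < a j, 0 < m j & upper_sum a m (a j) + m j = upper_sum a m theta].
Proof.
move=> s0; have [j0 hj0] : exists j, (theta < a j) && (0 < m j).
  apply/existsP; apply: contraNT s0 => /existsPn none.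
  rewrite /upper_sum big1// => j hj; apply/eqP; rewrite eq_le m_ge0 andbT leNgt.
  by have := none j; rewrite hj.
have [j /andP[hj mj] jmin] := @Order.TotalTheory.arg_minP _ _ _ j0
  [pred j | (theta < a j) && (0 < m j)] a hj0.
exists j; split => //; apply: upper_sum_step_eq => // l hl lj.
apply/eqP; rewrite eq_le m_ge0 andbT leNgt; apply/negP => ml.
by have := jmin l; rewrite inE hl ml => /(_ isT); rewrite leNgt lj.
Qed.

End upper_sum_steps.

(* The second disjunct puts the null set where the cdf vanishes into the leftmost
   cell, so that the cells of positive mass cover the whole line. *)
Definition sorted_cell (R : realType) (mu : probability (measurableTypeR R) R)
    (I : finType) (a m : I -> R) (i : I) : set (measurableTypeR R) :=
  [set x | rcdf mu x <= upper_sum a m (a i) + m i /\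
    (upper_sum a m (a i) < rcdf mu x \/ upper_sum a m (a i) = 0)].

Section sorted_cells.
Context (R : realType) (mu : probability (measurableTypeR R) R).
Hypotheses (mu_atomless : atomless mu)
  (moment : mu.-integrable setT (fun x : R => x%:E)).
Context (I : finType) (a m : I -> R).
Hypotheses (a_inj : injective a) (m_ge0 : forall i, 0 <= m i) (m_sum1 : \sum_i m i = 1).
Notation F := (rcdf mu).
Notation s i := (upper_sum a m (a i)).
Notation cell := (sorted_cell mu a m).

Lemma sorted_step_le1 i : s i + m i <= 1.
Proof.
have [L La] := finite_lower_bound a.
by rewrite -m_sum1 -(upper_sum_total m La); exact: upper_sum_step_le.
Qed.

Lemma connected_sorted_cell i : connected (cell i : set R).
Proof.
apply/connected_intervalP => x y [_ sx] [ty _] z /andP[xz zy]; split.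
  exact: le_trans (rcdf_le mu zy) ty.
by case: sx => [sx|]; [left; exact: lt_le_trans sx (rcdf_le mu xz)|right].
Qed.

Lemma sorted_cellE i :
  cell i = if s i == 0 then sublevel mu (s i + m i)
           else sublevel mu (s i + m i) `\` sublevel mu (s i).
Proof.
rewrite /sorted_cell /sublevel; case: eqP => si.
  by apply/seteqP; split => x /=; [case|split; [|right]].
apply/seteqP; split => x /= -[Fx sx]; split => //.
  by case: sx => // sx; apply/negP; rewrite -ltNge.
by left; rewrite ltNge; apply/negP.
Qed.

Lemma mu_sorted_cell i : mu (cell i) = (m i)%:E.
Proof.
have sm_ge0 : 0 <= s i + m i by rewrite addr_ge0// upper_sum_ge0.
rewrite sorted_cellE; case: eqP => [si|_].
  by rewrite mu_sublevel ?sm_ge0 ?sorted_step_le1// si add0r.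
have mC : measurable (sublevel mu (s i + m i) `\` sublevel mu (s i)).
  exact: measurable_slab.
rewrite -[LHS]fineK ?fin_num_measure// fine_mu_slab ?lerDl//.
rewrite !fine_mu_sublevel//; first by rewrite addrC addKr.
- by rewrite upper_sum_ge0//= (le_trans _ (sorted_step_le1 i))// lerDl.
- by rewrite sm_ge0 sorted_step_le1.
Qed.

Lemma Rintegral_sorted_cell i :
  \int[mu]_(x in cell i) (x : R) = lower_moment mu (s i + m i) - lower_moment mu (s i).
Proof.
rewrite sorted_cellE; case: eqP => [->|_]; first by rewrite lower_moment0// subr0.
by rewrite lower_momentB// lerDl.
Qed.

(** If [a i < a j], then cell [j] ends at level [s j + m j <= s i]. As [m j > 0] forces [s i > 0],
    the exceptional clause of cell [i] cannot hold, so cell [i] lies strictly above that level. *)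
Lemma sorted_cell_disjoint i j x : 0 < m i -> 0 < m j -> cell i x -> cell j x -> i = j.
Proof.
suff lt_absurd i' j' : 0 < m j' -> a i' < a j' -> cell i' x -> cell j' x -> False.
  move=> mi mj ci cj; apply: a_inj; case: (ltgtP (a i) (a j)) => // ij.
    by have := lt_absurd _ _ mj ij ci cj.
  by have := lt_absurd _ _ mi ij cj ci.
move=> mj ij [_ sx] [tx _]; have := upper_sum_step_le m_ge0 ij.
have := upper_sum_ge0 a m_ge0 (a j').
by case: sx => sx; lra.
Qed.

(** Among the cells of positive mass that do not end before [x], take the leftmost, that is, the one
    with largest [a i]. Were [x] not past its start, the preceding cell would qualify too. *)
Lemma sorted_cell_cover x : exists i, 0 < m i /\ cell i x.
Proof.
have [L La] := finite_lower_bound a.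
(* The rightmost cell of positive mass ends at level 1, so some candidate exists. *)
have [i0 [_ mi0 ti0]] : exists j, [/\ L < a j, 0 < m j & s j + m j = upper_sum a m L].
  by apply: upper_sum_next => //; rewrite upper_sum_total// m_sum1 oner_neq0.
have hi0 : (0 < m i0) && (F x <= s i0 + m i0).
  by rewrite mi0 ti0 upper_sum_total// m_sum1 rcdf_le1.
have [i /andP[mi xi] imax] := @Order.TotalTheory.arg_maxP _ _ _ i0
  [pred i | (0 < m i) && (F x <= s i + m i)] a hi0.
exists i; split => //; split => //.
have [->|si] := eqVneq (s i) 0; [by right|left].
have [j [ij mj <-]] := upper_sum_next a_inj m_ge0 si.
rewrite ltNge; apply/negP => xj.
by have := imax j; rewrite inE mj xj => /(_ isT) /=; rewrite leNgt ij.
Qed.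

Lemma sorted_cell_decomposition :
  interval_decomposition
    (fun i : 'I_#|[pred i | 0 < m i]| => cell (enum_val i) : set R).
Proof.
have m_gt0 (i : 'I_#|[pred i | 0 < m i]|) : 0 < m (enum_val i).
  by have := enum_valP i; rewrite inE.
split.
- rewrite -subTset => x _; have [i [mi xi]] := sorted_cell_cover x.
  have ii : i \in [pred i | 0 < m i] by rewrite inE.
  by exists (enum_rank_in ii i) => //; rewrite enum_rankK_in.
- move=> i j _ _ [x [xi xj]]; apply: enum_val_inj.
  exact: sorted_cell_disjoint xi xj.
- move=> i; apply/set0P/eqP => c0; have := mu_sorted_cell (enum_val i).
  by rewrite c0 measure0 => -[m0]; have := m_gt0 i; rewrite -m0 ltxx.
- by move=> i; exact: connected_sorted_cell.
Qed.

End sorted_cells.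

(** Cells are paired by their index [i], though they may come in different orders on the two axes.
    On each pair the minimum is at most the value of the [i]-th function. *)
Lemma sorted_partition (R : realType) (mu nu : probability (measurableTypeR R) R)
    (n : nat) (a b c m : 'I_n.+1 -> R) :
  atomless mu -> mu.-integrable setT (fun x : R => x%:E) ->
  atomless nu -> nu.-integrable setT (fun x : R => x%:E) ->
  injective a -> injective b -> (forall i, 0 <= m i) -> \sum_i m i = 1 ->
  exists k (I J : 'I_k -> set R), [/\ (k <= n.+1)%N, mpartition mu nu I J &
    partition_cost mu nu a b c I J <= mass_cost mu nu a b c m].
Proof.
move=> mu_atomless mu_moment nu_atomless nu_moment a_inj b_inj m_ge0 m_sum1.
pose k := #|[pred i | 0 < m i]|.
exists k, (fun i => sorted_cell mu a m (enum_val i)), (fun i => sorted_cell nu b m (enum_val i)).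
split.
- by rewrite -[leqRHS]card_ord; exact: max_card.
- split; [exact: sorted_cell_decomposition|exact: sorted_cell_decomposition|].
  move=> i; rewrite !mu_sorted_cell//; split => //.
  by have := enum_valP i; rewrite inE lte_fin.
pose cost i := a i * (lower_moment mu (upper_sum a m (a i) + m i) -
                      lower_moment mu (upper_sum a m (a i)))
  + b i * (lower_moment nu (upper_sum b m (b i) + m i) -
           lower_moment nu (upper_sum b m (b i))) + c i * m i.
have -> : mass_cost mu nu a b c m = \sum_i cost i by rewrite !big_split.
(* Massless indices have zero increments, so dropping them leaves the sum unchanged. *)
have -> : \sum_i cost i = \sum_(i < k) cost (enum_val i).
  rewrite -(big_enum_val cost) [RHS]big_mkcond; apply: eq_bigr => i _; rewrite inE.
  case: ifPn => //; rewrite lt_neqAle m_ge0 andbT negbK => /eqP m0.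
  by rewrite /cost -m0 !addr0 !subrr !mulr0 !addr0.
apply: ler_sum => i _; apply: le_trans (fmin_le _ (enum_val i)) _.
by rewrite !Rintegral_sorted_cell// mu_sorted_cell.
Qed.

(** * Distinct slopes and the equality of the two minima *)

Lemma nondegenerate_slope1 (R : realType) (a1 b1 c1 a2 b2 c2 : R) :
  nondegenerate_pair (affine2 a1 b1 c1) (affine2 a2 b2 c2) -> a1 <> a2.
Proof.
move=> [l12 [p0]]; rewrite /affine2/= => E0 nhoriz _ a12; subst a2.
(* The difference of the two functions now depends on [y] alone. If it is constant, it vanishes
   because it does at [p0]; otherwise its zero set is the horizontal line through [p0]. *)
have [b12|b12] := eqVneq b1 b2.
  subst b2; apply: l12; apply/funext => p; rewrite /affine2; lra.
have bn0 : b1 - b2 != 0 by rewrite subr_eq0.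
apply: nhoriz; exists p0.2; apply/seteqP; split => p /=; last by move=> ->; lra.
move=> Ep; apply: (mulfI bn0); lra.
Qed.

Lemma nondegenerate_slope2 (R : realType) (a1 b1 c1 a2 b2 c2 : R) :
  nondegenerate_pair (affine2 a1 b1 c1) (affine2 a2 b2 c2) -> b1 <> b2.
Proof.
move=> [l12 [p0]]; rewrite /affine2/= => E0 _ nvert b12; subst b2.
have [a12|a12] := eqVneq a1 a2.
  subst a2; apply: l12; apply/funext => p; rewrite /affine2; lra.
have an0 : a1 - a2 != 0 by rewrite subr_eq0.
apply: nvert; exists p0.1; apply/seteqP; split => p /=; last by move=> ->; lra.
move=> Ep; apply: (mulfI an0); lra.
Qed.

Theorem theorem2p9 (R : realType)
    (mu nu : probability (measurableTypeR R) R)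
    (mu_atomless : atomless mu) (nu_atomless : atomless nu)
    (mu_moment : mu.-integrable setT (fun x : R => x%:E))
    (nu_moment : nu.-integrable setT (fun y : R => y%:E))
    (n : nat) (a b c : 'I_n.+1 -> R)
    (l_nondegenerate : forall i j, i <> j ->
       nondegenerate_pair (affine2 (a i) (b i) (c i))
                          (affine2 (a j) (b j) (c j)))
    (l_interior : forall i,
       interior [set p : R * R |
         min_affine a b c p = affine2 (a i) (b i) (c i) p] !=set0) :
  exists m : R,
    is_minimum
      [set v | exists k : nat, exists I J : 'I_k -> set R,
         [/\ (k <= n.+1)%N, mpartition mu nu I J &
             v = partition_cost mu nu a b c I J]] m /\
    is_minimum
      [set v | exists pi : probability
                 (measurableTypeR R * measurableTypeR R)%type R,
         transport_plan mu nu pi /\ v = \int[pi]_p min_affine a b c p] m.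
Proof.
have a_inj : injective a.
  move=> i j aij; apply: contrapT => /l_nondegenerate.
  by move=> /nondegenerate_slope1; exact.
have b_inj : injective b.
  move=> i j bij; apply: contrapT => /l_nondegenerate.
  by move=> /nondegenerate_slope2; exact.
have [m [m_ge0 m_sum1 m_min]] :=
  mass_cost_min a b c mu_atomless mu_moment nu_atomless nu_moment.
set v := mass_cost mu nu a b c m in m_min.
have plan_ge pi : transport_plan mu nu pi -> v <= \int[pi]_p min_affine a b c p.
  move=> plan_pi; have [m' [m'_ge0 m'_sum1]] := mass_cost_le_plan
    mu_atomless nu_atomless mu_moment nu_moment plan_pi c a_inj b_inj.
  by apply: le_trans; exact: m_min.
have [k [I [J [kn partIJ IJ_le]]]] := sorted_partition c
  mu_atomless mu_moment nu_atomless nu_moment a_inj b_inj m_ge0 m_sum1.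
have [pi [plan_pi pi_le]] := partition_plan mu_moment nu_moment a b c partIJ.
(* The cycle [v] <= plan cost <= partition cost <= [v] closes, so one partition and its coupling
   attain both minima. *)
have IJ_eq : v = partition_cost mu nu a b c I J.
  by apply/eqP; rewrite eq_le IJ_le (le_trans (plan_ge _ plan_pi)).
have pi_eq : v = \int[pi]_p min_affine a b c p.
  by apply/eqP; rewrite eq_le plan_ge// (le_trans pi_le).
exists v; split; split.
- by exists k, I, J.
- move=> _ [k' [I' [J' [_ /(partition_plan mu_moment nu_moment a b c)[pi' [plan' le']] ->]]]].
  exact: le_trans (plan_ge _ plan') le'.
- by exists pi.
- by move=> _ [pi' [plan' ->]]; exact: plan_ge.
Qed.
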